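(* Let $G$ be a finitely generated group, fix a finite symmetric generating set, let $B_n$ denote the ball of radius $n$ about the identity in the associated word metric, and suppose there are an integer $d\ge 0$ and a constant $C>0$ with $|B_n|\le C n^d$ for all $n\ge 1$. Then every continuous action $G\curvearrowright X$ on a compact metric space $X$ has weak $2^{d}$-comparison: for all open sets $A,B\subseteq X$ with $\overline{D}(A)<\underline{D}(B)$ we have $A\prec_{2^d}B$.
   Context: Lower and upper densities of $A\subseteq X$: $\underline{D}(A)=\sup_{F\Subset G}\inf_{x\in X}\frac{1}{|F|}\sum_{s\in F}1_A(sx)$ and $\overline{D}(A)=\inf_{F\Subset G}\sup_{x\in X}\frac{1}{|F|}\sum_{s\in F}1_A(sx)$, with $F$ ranging over nonempty finite subsets of $G$. For $A,B\subseteq X$ and integer $k\ge0$, $A\prec_k B$ means that for every closed $C\subseteq A$ there are a finite open cover $\mathscr U$ of $C$, an element $s_U\in G$ for each $U\in\mathscr U$, and a partition $\mathscr U=\mathscr U_0\sqcup\dots\sqcup\mathscr U_k$ such that for each $i$ the sets $s_UU$, $U\in\mathscr U_i$, are pairwise disjoint and contained in $B$. *)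

(* Defs.v *)
From HB Require Import structures.
From mathcomp Require Import all_boot all_order all_algebra.
From mathcomp Require Import finmap.
From mathcomp Require Import all_classical all_reals all_analysis.
Set Implicit Arguments. Unset Strict Implicit. Unset Printing Implicit Defensive.
Import Order.TTheory GRing.Theory Num.Theory.
Local Open Scope classical_set_scope.
Local Open Scope ring_scope.

Definition word_ball (G : groupType) (S : {fset G}) (n : nat) : set G :=
  [set g | exists w : seq G,
     (size w <= n)%N /\ all (fun s => s \in S) w /\
     g = foldr (fun a b => (a * b)%g) 1%g w].

Definition symmetric_set (G : groupType) (S : {fset G}) : Prop :=
  forall s, s \in S -> (s^-1)%g \in S.

Definition generates (G : groupType) (S : {fset G}) : Prop :=
  forall g : G, exists n : nat, word_ball S n g.

Definition is_action (G : groupType) (X : Type) (act : G -> X -> X) : Prop :=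
  (forall x, act 1%g x = x) /\
  (forall g h x, act (g * h)%g x = act g (act h x)).

Definition davg (R : realType) (G : groupType) (X : Type) (act : G -> X -> X)
  (A : set X) (F : {fset G}) (x : X) : R :=
  (\sum_(s <- F) (\1_A (act s x) : R)) / (#|` F|)%fset%:R.

Definition lower_density (R : realType) (G : groupType) (X : Type)
  (act : G -> X -> X) (A : set X) : R :=
  sup [set r : R | exists F : {fset G}, (F != fset0)%fset /\
        r = inf [set davg R act A F x | x in [set: X]]].

Definition upper_density (R : realType) (G : groupType) (X : Type)
  (act : G -> X -> X) (A : set X) : R :=
  inf [set r : R | exists F : {fset G}, (F != fset0)%fset /\
        r = sup [set davg R act A F x | x in [set: X]]].

Definition prec_k (G : groupType) (X : topologicalType) (act : G -> X -> X)
  (k : nat) (A B : set X) : Prop :=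
  forall C : set X, closed C -> C `<=` A ->
  exists (n : nat) (U : 'I_n -> set X) (s : 'I_n -> G) (c : 'I_n -> 'I_k.+1),
    (forall i, open (U i)) /\
    C `<=` \bigcup_(i in [set: 'I_n]) U i /\
    (forall i, act (s i) @` U i `<=` B) /\
    (forall i j, c i = c j -> i != j ->
       act (s i) @` U i `&` act (s j) @` U j = set0).

(* Main.v *)
Require Import Defs.
From HB Require Import structures.
From mathcomp Require Import all_boot all_order all_algebra.
From mathcomp Require Import finmap.
From mathcomp Require Import all_classical all_reals all_analysis.
Import Order.TTheory GRing.Theory Num.Theory.
Local Open Scope classical_set_scope.
Local Open Scope ring_scope.

(** Cover C greedily: run through all pairs (g, c) of an element g of the ball
    B_r and a color c, and at each step use g, in color c, on the part of the
    uncovered set C that g sends into the free room B_c.  The step replaces C by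
    C \ g^-1 B_c, which stays closed, and B_c by B_c \ g C, which stays open.
    Along the orbit of a point x, each h in B_r whose hx is removed from B_c is
    paid for by the element g^-1 h of B_2r, whose image of x is removed from C,
    so the quantity
      sum_c #{h in B_r : hx in B_c} - #{h in B_2r : hx in C}
    never decreases.  It is positive at the start, whereas for a point x left
    uncovered at the end no h in B_r has hx in a remaining B_c; hence no point
    is left.  If the gap between the densities is witnessed on finite subsets of
    B_m, initial positivity with 2^d + 1 colors holds for r = n + m as soon as
    |B_(2n + 3m)| <= (2^d + 1) |B_n|; polynomial growth provides such an n,
    since iterating the reverse inequality gives growth of order > d. *)

(** * Polynomial growth and a good scale *)

Lemma bernoulli_ineq (R : realDomainType) (x : R) (k : nat) :
  0 <= x -> 1 + x *+ k <= (1 + x) ^+ k.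
Proof.
move=> x0; elim: k => [|k IH]; first by rewrite mulr0n addr0 expr0.
rewrite exprS (le_trans _ (ler_wpM2l _ IH)) ?addr_ge0//.
rewrite mulrDl mul1r mulrDr mulr1 mulrSr !addrA.
by rewrite lerDl mulr_ge0 ?mulrn_wge0.
Qed.

(** If every [n] failed, iterating [n -> 2n + 3m] from 1 would multiply [f] by more than [2^d + 1]
    each time, while the bound on [f] allows only a factor [2^d] per step up to a constant. The
    ratio [(1 + 2^-d)^k] is unbounded by Bernoulli. *)
Lemma doubling_scale (R : realType) (f : nat -> R) (d m : nat) (Cst : R) :
  0 < f 1%N -> (forall n, (1 <= n)%N -> f n <= Cst * n%:R ^+ d) ->
  exists n, f (2 * n + 3 * m)%N <= (2 ^ d).+1%:R * f n.
Proof.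
move=> f1 fle; apply: contrapT => /forallNP nle.
pose u := fix u k := if k is k'.+1 then (2 * u k' + 3 * m)%N else 1%N.
have u1 k : (1 <= u k)%N.
  by elim: k => //= k IH; rewrite (leq_trans IH)// mul2n -addnn -addnA leq_addr.
(* Adding [3m] turns the recursion into pure doubling. *)
have uE k : (u k + 3 * m = 2 ^ k * (1 + 3 * m))%N.
  elim: k => [|k IH] /=; first by rewrite mul1n.
  by rewrite expnS -mulnA -IH mulnDr -addnA addnn -mul2n.
have grow k : (2 ^ d).+1%:R ^+ k * f 1%N <= f (u k).
  elim: k => [|k IH]; first by rewrite expr0 mul1r.
  rewrite exprS -mulrA (le_trans (ler_wpM2l _ IH))//=.
  by have /negP := nle (u k); rewrite -ltNge => /ltW.
have Cst0 : 0 <= Cst.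
  by have := lt_le_trans f1 (fle 1%N isT); rewrite expr1n mulr1 => /ltW.
pose D := Cst * (1 + 3 * m)%:R ^+ d.
have p2 : 0 < (2 ^ d)%:R :> R by rewrite ltr0n expn_gt0.
have bnd k : (1 + (2 ^ d)%:R^-1) ^+ k * f 1%N <= D.
  have q0 : 0 < (2 ^ d)%:R ^+ k :> R by rewrite exprn_gt0.
  rewrite -(ler_pM2l q0) mulrA -exprMn mulrDr mulr1 divff ?gt_eqF//.
  rewrite natr1 (le_trans (grow k))// (le_trans (fle _ (u1 k)))//.
  rewrite /D mulrCA ler_wpM2l// natrX exprAC -exprMn -(natrX _ 2 k).
  by rewrite lerXn2r ?nnegrE// -natrM ler_nat -uE leq_addr.
have D0 : 0 <= D by rewrite /D mulr_ge0 ?exprn_ge0 ?ler0n.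
have b0 : 0 <= D / f 1%N * (2 ^ d)%:R by rewrite !mulr_ge0 ?invr_ge0 ?(ltW f1) ?(ltW p2).
(* This [k] exceeds [2^d D / f 1], so [1 + k / 2^d] exceeds [D / f 1]. *)
have := archi_boundP b0; set k := Num.bound _ => /lt_le_trans klt.
have := bnd k; rewrite -ler_pdivlMr// => /(le_trans (bernoulli_ineq _ _ k (ltW _))).
rewrite invr_gt0 => /(_ p2) h.
have : D / f 1%N * (2 ^ d)%:R < D / f 1%N * (2 ^ d)%:R.
  apply: klt; rewrite -ler_pdivrMr//; apply: le_trans h.
  by rewrite mulr_natl lerDr.
by rewrite ltxx.
Qed.

(** * Greedy covering in a normal space *)

Lemma count_inj_le (T : choiceType) (P Q : pred T) (F H : {fset T})
  (f : T -> T) : injective f ->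
  (forall t, t \in F -> P t -> (f t \in H) && Q (f t)) ->
  (count P F <= count Q H)%N.
Proof.
move=> f_inj PQ; rewrite -!size_filter -(size_map f).
apply: uniq_leq_size; first by rewrite map_inj_uniq// filter_uniq.
move=> _ /mapP[t + ->]; rewrite !mem_filter => /andP[Pt tF].
by rewrite andbC PQ.
Qed.

Lemma action_imageE (G : groupType) (X : Type) (act : G -> X -> X) (g : G)
  (A : set X) : is_action act -> act g @` A = act (g^-1)%g @^-1` A.
Proof.
move=> [act1 actM]; apply/seteqP; split => [_ [x Ax <-]|x Ax] /=.
  by rewrite -actM mulVg act1.
by exists (act (g^-1)%g x) => //; rewrite -actM mulgV act1.
Qed.

Lemma normal_shrink (X : topologicalType) (D O : set X) :
  normal_space X -> closed D -> open O -> D `<=` O ->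
  exists U, [/\ open U, D `<=` U & closure U `<=` O].
Proof.
move=> nX cD oO DO.
have [|V /set_nbhsP[U [oU DU UV]] VO] := nX D cD O.
  by apply/set_nbhsP; exists O; split.
by exists U; split=> //; apply: subset_trans VO; exact: closureS.
Qed.

(* The list [l] holds the greedy steps still to be made, [C] the points still
   to be covered and [B c] the room left in color [c].  Closures in the
   conclusion leave the slack needed to thicken the locally closed pieces of
   the earlier steps. *)
Lemma greedy_cover (G : groupType) (X : topologicalType) (act : G -> X -> X)
  (K L : {fset G}) (k : nat) :
  normal_space X -> is_action act -> (forall g, continuous (act g)) ->
  {in K &, forall g h, (g^-1 * h)%g \in L} ->
  forall l : seq (G * 'I_k.+1), {subset [seq p.1 | p <- l] <= K} ->
  forall (C : set X) (B : 'I_k.+1 -> set X), closed C -> (forall c, open (B c)) ->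
  (forall x g c, C x -> g \in K -> B c (act g x) -> (g, c) \in l) ->
  (forall x, C x -> (count (fun h => act h x \in C) L <
                     \sum_c count (fun g => act g x \in B c) K)%N) ->
  exists (n : nat) (U : 'I_n -> set X) (s : 'I_n -> G) (c : 'I_n -> 'I_k.+1),
    [/\ forall i, open (U i), C `<=` \bigcup_i U i,
        forall i, act (s i) @` closure (U i) `<=` B (c i) &
        forall i j, c i = c j -> i != j ->
          act (s i) @` U i `&` act (s j) @` U j = set0].
Proof.
move=> nX actA act_cont KL.
elim=> [_ C B _ _ Bl CB|[g1 c1] l IH lK C B cC oB Bl CB].
  (* With no step left, no point of [C] is sent by [K] into any room, so the strict inequality
     leaves [C] empty. *)
  exists 0%N, (fun=> set0), (fun=> 1%g), (fun=> ord0).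
  suff -> : C = set0 by split=> [[]|//|[]|[]].
  apply/seteqP; split=> // x Cx; have := CB x Cx.
  rewrite big1 ?ltn0// => c _; apply/eqP; rewrite -leqn0 leqNgt -has_count.
  by apply/hasPn => g gK; apply/negP; rewrite inE => /(Bl _ _ _ Cx gK).
have [act1 actM] := actA.
have actK g : cancel (act g) (act (g^-1)%g).
  by move=> x; rewrite -actM mulVg act1.
have cimg g A : closed A -> closed (act g @` A).
  move=> cA; rewrite action_imageE//.
  by apply: preimage_closed cA => x _; exact: act_cont.
have oimg g A : open A -> open (act g @^-1` A).
  by move=> oA; apply: open_comp => // x _; exact: act_cont.
have g1K : g1 \in K by apply: lK; rewrite mem_head.
pose C' := C `\` act g1 @^-1` B c1.
pose B' c := if c == c1 then B c `\` act g1 @` C else B c.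
have B'B c : B' c `<=` B c by rewrite /B'; case: ifP => _ y // [].
have [|||||n [U [s [c [oU CU UB Udisj]]]]] := IH _ C' B'.
- by move=> g gl; apply: lK; rewrite inE gl orbT.
- rewrite /C' setDE; apply: closedI => //; apply: open_closedC.
  exact/oimg/oB.
- move=> c; rewrite /B'; case: ifP => // _; rewrite setDE.
  by apply: openI => //; apply: closed_openC; exact: cimg.
(* The pair [(g1, c1)] may leave the list: [g1] sends no point of [C'] into [B c1]. *)
- move=> x g c [Cx nBx] gK /B'B Bx.
  have := Bl _ _ _ Cx gK Bx; rewrite inE => /orP[/eqP[gE cE]|//].
  by case: nBx; rewrite /= -gE -cE.
- move=> x [Cx _].
  (* [E] is the part of [C] covered by this step; visits to it pay for the room lost in color
     [c1]. *)
  pose E := C `&` act g1 @^-1` B c1.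
  have CE : (count (fun h => act h x \in C) L =
      count (fun h => act h x \in C') L + count (fun h => act h x \in E) L)%N.
    rewrite -count_predUI [X in (_ + X)%N](_ : _ = 0)%N ?addn0.
      apply: eq_count => h /=; apply/idP/orP.
        rewrite !inE => Ch; case: (pselect (B c1 (act g1 (act h x)))) => Bh.
          by right.
        by left.
      by rewrite !inE => -[[]|[]].
    apply/eqP; rewrite -leqn0 leqNgt -has_count; apply/hasPn => h _.
    by apply/negP => /andP[]; rewrite !inE => -[_ nB] [_].
  have BE c : (count (fun g => act g x \in B c) K <=
      count (fun g => act g x \in B' c) K +
      (if c == c1 then count (fun h => act h x \in E) L else 0))%N.
    rewrite /B'; case: eqP => [->|_]; last by rewrite addn0.
    apply: (@leq_trans (count (fun g => act g x \in B c1 `\` act g1 @` C) K +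
      count (fun g => act g x \in B c1 `&` act g1 @` C) K)%N).
      rewrite -count_predUI; apply: leq_trans (leq_addr _ _).
      apply: sub_count => g; rewrite inE => Bg; apply/orP; rewrite !inE.
      case: (pselect ((act g1 @` C) (act g x))) => gC; first by right.
      by left.
    (* Each [g] in [K] with [g x] in the removed room yields [g1^-1 g] in [L], which sends [x] into
       [E]. *)
    rewrite leq_add2l; apply: (count_inj_le _ _ _ _ _ _ (mulgI (g1^-1)%g)) => g gK.
    rewrite inE KL//= => -[Bg [z Cz zE]]; apply/mem_set.
    split; first by rewrite actM -zE actK.
    by rewrite /= -actM mulVKg.
  have := CB x Cx; rewrite CE => /leq_trans/(_ (leq_sum _ (fun c _ => BE c))).
  by rewrite big_split/= -big_mkcond big_pred1_eq ltn_add2r.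
(* The pieces found for [C'] are already open, so the points of [C] they miss
   form a closed set, and step (g1, c1) carries it into what these pieces leave
   free in [B c1]. *)
pose O := act g1 @^-1` (B c1 `\`
  \bigcup_(i in [set i | c i = c1]) act (s i) @` closure (U i)).
have [||| U1 [oU1 CU1 U1O]] := normal_shrink _ (C `\` \bigcup_i U i) O nX.
- rewrite setDE; apply: closedI => //; apply: open_closedC.
  exact: bigcup_open.
- apply: oimg; rewrite setDE; apply: openI => //; apply: closed_openC.
  apply: closed_bigcup => [|i _]; first exact: finite_finset.
  apply: cimg; exact: closed_closure.
(* A missed point is outside [C'], so [g1] sends it into [B c1]; pieces of color [c1] land in
   [B' c1], which avoids [g1 C]. *)
- move=> x [Cx nUx]; split.
    by apply: contrapT => nBx; apply: nUx; apply: CU.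
  move=> [i /= ci /UB]; rewrite ci /B' eqxx => -[_]; apply.
  by exists x.
have U1disj j : c j = c1 -> act g1 @` U1 `&` act (s j) @` U j = set0.
  move=> cj; apply/seteqP; split=> // _ [[y U1y <-] [z Uz zE]].
  have [_] := U1O _ (subset_closure U1y); apply; exists j => //.
  by exists z => //; exact: subset_closure.
exists n.+1, (fun i => oapp U U1 (unlift ord0 i)),
  (fun i => oapp s g1 (unlift ord0 i)), (fun i => oapp c c1 (unlift ord0 i)).
split.
- by move=> i; case: unliftP => [j|] _ /=.
- move=> x Cx; case: (pselect ((\bigcup_i U i) x)) => [[i _ Ux]|nUx].
    by exists (lift ord0 i) => //; rewrite liftK.
  by exists ord0 => //; rewrite unlift_none; apply: CU1.
- move=> i; case: unliftP => [j|] _ /=; first by apply: subset_trans (B'B _).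
  by move=> _ [y /U1O[By _] <-].
- move=> i j; case: unliftP => [i'|] ->; case: unliftP => [j'|] -> //=.
  + by move=> cij; rewrite (inj_eq lift_inj) => ?; exact: Udisj.
  + by move=> ci _; rewrite setIC; exact: U1disj.
  + by move=> cj _; exact: U1disj.
Qed.

(** * Balls of the word metric *)

(** Needed for [fset_set] to return the ball itself rather than its default value, the empty set. *)
Lemma word_ball_finite (G : groupType) (S : {fset G}) (n : nat) :
  finite_set (word_ball S n).
Proof.
elim: n => [|n IH].
  apply: sub_finite_set (finite_set1 1%g) => g [w []].
  by rewrite leqn0 => /nilP -> [_ ->].
apply: (@sub_finite_set _ _ ([set 1%g] `|`
  [set (a * b)%g | a in [set` S] & b in word_ball S n])).
  move=> g [[|a w] /= [sw [aS ->]]]; first by left.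
  move: aS => /andP[aS wS]; right; exists a => //; exists (foldr (fun a b => (a * b)%g) 1%g w) => //.
  by exists w.
rewrite finite_setU; split; first exact: finite_set1.
by apply: finite_image2 => //; exact: finite_fset.
Qed.

Lemma mem_word_ball (G : groupType) (S : {fset G}) (n : nat) (g : G) :
  (g \in fset_set (word_ball S n)) <-> word_ball S n g.
Proof. by rewrite in_fset_set ?inE//; exact: word_ball_finite. Qed.

Lemma foldr_mulg_cat (G : groupType) (v w : seq G) :
  foldr (fun a b => (a * b)%g) 1%g (v ++ w) =
  (foldr (fun a b => (a * b)%g) 1%g v * foldr (fun a b => (a * b)%g) 1%g w)%g.
Proof. by elim: v => [|a v IH] /=; rewrite ?mul1g// IH mulgA. Qed.

Lemma word_ballM (G : groupType) (S : {fset G}) (m n : nat) (g h : G) :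
  word_ball S m g -> word_ball S n h -> word_ball S (m + n) (g * h)%g.
Proof.
move=> [v [sv [vS ->]]] [w [sw [wS ->]]]; exists (v ++ w).
by rewrite size_cat leq_add// all_cat vS wS foldr_mulg_cat.
Qed.

Lemma word_ballV (G : groupType) (S : {fset G}) (n : nat) (g : G) :
  symmetric_set S -> word_ball S n g -> word_ball S n (g^-1)%g.
Proof.
move=> symS [w [sw [wS ->]]]; elim: w n sw wS => [|a w IH] [|n]//=.
- by exists [::]; rewrite /= invg1.
- by exists [::]; rewrite /= invg1.
- move=> sw /andP[aS wS]; rewrite invgM -[n.+1]addn1.
  apply: word_ballM; first exact: IH.
  by exists [:: (a^-1)%g]; rewrite /= symS// mulg1.
Qed.

Lemma word_ballS (G : groupType) (S : {fset G}) (m n : nat) :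
  (m <= n)%N -> word_ball S m `<=` word_ball S n.
Proof. by move=> mn g [w [sw ?]]; exists w; rewrite (leq_trans sw). Qed.

Lemma word_ball1 (G : groupType) (S : {fset G}) (n : nat) :
  word_ball S n 1%g.
Proof. by exists [::]. Qed.

Lemma fset_sub_word_ball (G : groupType) (S F : {fset G}) :
  generates S -> exists m, forall g, g \in F -> word_ball S m g.
Proof.
move=> genS; elim/finSet_rect: F => F IH.
have [->|[g gF]] := fset_0Vmem F; first by exists 0%N.
have [m Hm] := IH _ (fproperD1 gF); have [n Hn] := genS g.
exists (m + n)%N => h hF; have [->|hg] := eqVneq h g.
  exact: word_ballS (leq_addl _ _) _ Hn.
by apply: word_ballS (leq_addr _ _) _ (Hm h _); rewrite !inE hg.
Qed.

(** * From densities to counts over finite sets *)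

Section Density.
Variables (R : realType) (G : groupType) (X : Type) (act : G -> X -> X).

Lemma davgE (A : set X) (F : {fset G}) (x : X) :
  Defs.davg R act A F x =
  (count (fun s => act s x \in A) F)%:R / (#|` F|)%fset%:R :> R.
Proof.
rewrite /Defs.davg -sum1_count natr_sum [in RHS]big_mkcond; congr (_ / _).
by apply: eq_bigr => s _; rewrite indicE; case: (_ \in _).
Qed.

Lemma davg_ge0 (A : set X) (F : {fset G}) (x : X) : 0 <= Defs.davg R act A F x :> R.
Proof. by rewrite davgE divr_ge0. Qed.

Lemma davg_le1 (A : set X) (F : {fset G}) (x : X) : Defs.davg R act A F x <= 1 :> R.
Proof.
rewrite davgE; have [->|F0] := eqVneq (#|` F|)%fset 0%N; first by rewrite invr0 mulr0.
by rewrite ler_pdivrMr ?ltr0n ?lt0n// mul1r ler_nat count_size.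
Qed.

Lemma density_gap (A B : set X) :
  upper_density R act A < lower_density R act B ->
  exists (F H : {fset G}) (a b : R), [/\ F != fset0, H != fset0, a < b,
    forall x, Defs.davg R act A F x <= a & forall x, b <= Defs.davg R act B H x].
Proof.
have ne1 : [fset 1%g : G]%fset != fset0.
  by apply/fset0Pn; exists 1%g; rewrite inE.
move=> /sup_gt[]; first by eexists; exists [fset 1%g]%fset; split=> //.
move=> _ [H [H0 ->]] /inf_lt[]; first by eexists; exists [fset 1%g]%fset; split=> //.
move=> _ [F [F0 ->]] lt_FH; exists F, H.
exists (sup [set Defs.davg R act A F x | x in [set: X]]).
exists (inf [set Defs.davg R act B H x | x in [set: X]]); split=> // x.
- apply: ub_le_sup; last by exists x.
  by exists 1 => _ [y _ <-]; exact: davg_le1.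
- apply: ge_inf; last by exists x.
  by exists 0 => _ [y _ <-]; exact: davg_ge0.
Qed.

Hypothesis actA : is_action act.

Lemma sum_davg (A : set X) (F K : {fset G}) (x : X) :
  \sum_(t <- K) Defs.davg R act A F (act t x) =
  (\sum_(s <- F) count (fun t => act (s * t)%g x \in A) K)%:R /
    (#|` F|)%fset%:R.
Proof.
rewrite (eq_bigr _ (fun t _ => davgE A F (act t x))).
rewrite -mulr_suml -natr_sum; congr (_%:R / _).
under eq_bigr do rewrite -sum1_count big_mkcond.
rewrite exchange_big; apply: eq_bigr => s _.
rewrite -sum1_count [RHS]big_mkcond; apply: eq_bigr => t _.
by case: actA => _ ->.
Qed.

Lemma sum_fset_const (F : {fset G}) (n : nat) :
  (\sum_(s <- F) n = n * #|` F|)%N.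
Proof. by rewrite big_const_seq iter_addn_0 count_predT. Qed.

(** Average over [K]: for each [s] in [H], [t -> s t] injects the hits counted over [K] into those
    over [N]. *)
Lemma count_ge_davg (B : set X) (H K N : {fset G}) (b : R) (x : X) :
  H != fset0 -> (forall y, b <= Defs.davg R act B H y) ->
  (forall s t, s \in H -> t \in K -> (s * t)%g \in N) ->
  b * (#|` K|)%fset%:R <= (count (fun g => act g x \in B) N)%:R.
Proof.
move=> H0 bH HK; apply: (@le_trans _ _
  (\sum_(t <- K) Defs.davg R act B H (act t x))).
  rewrite -sum1_size natr_sum mulr_sumr; apply: ler_sum => t _.
  by rewrite mulr1.
rewrite sum_davg ler_pdivrMr ?ltr0n ?cardfs_gt0// -natrM ler_nat.
rewrite -sum_fset_const !(big_seq _ _ (enum_fset H))/=.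
apply: leq_sum => s sH; apply: (count_inj_le _ _ _ _ _ _ (mulgI s)) => t tK ->.
by rewrite HK.
Qed.

(** The same averaging, with [t -> s^-1 t] injecting hits over [N] into hits over [K]. *)
Lemma count_le_davg (A : set X) (F K N : {fset G}) (a : R) (x : X) :
  F != fset0 -> (forall y, Defs.davg R act A F y <= a) ->
  (forall s t, s \in F -> t \in N -> (s^-1 * t)%g \in K) ->
  (count (fun g => act g x \in A) N)%:R <= a * (#|` K|)%fset%:R.
Proof.
move=> F0 aF FN; apply: (@le_trans _ _
  (\sum_(t <- K) Defs.davg R act A F (act t x))).
  rewrite sum_davg ler_pdivlMr ?ltr0n ?cardfs_gt0// -natrM ler_nat.
  rewrite -sum_fset_const !(big_seq _ _ (enum_fset F))/=.
  apply: leq_sum => s sF.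
  apply: (count_inj_le _ _ _ _ _ _ (mulgI (s^-1)%g)) => t tN At.
  by rewrite FN//= mulVKg.
rewrite -sum1_size natr_sum mulr_sumr; apply: ler_sum => t _.
by rewrite mulr1.
Qed.
End Density.

(** * Comparison from the counting inequality on balls *)

Theorem mainTheorem5 (R : realType) (G : groupType) (S : {fset G})
  (d : nat) (Cst : R) :
  symmetric_set S -> generates S -> 0 < Cst ->
  (forall n : nat, (1 <= n)%N ->
     (#|` fset_set (word_ball S n)|)%fset%:R <= Cst * (n%:R) ^+ d) ->
  forall (X : metricType R) (act : G -> X -> X),
    compact [set: X] -> is_action act -> (forall g : G, continuous (act g)) ->
    forall A B : set X, open A -> open B ->
      upper_density R act A < lower_density R act B ->
      prec_k act (2 ^ d) A B.
Proof.
move=> symS genS _ grow X act _ actA act_cont A B _ oB.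
move=> /density_gap[F [H [a [b [F0 H0 ltab aF bH]]]]] C cC CA.
pose K n := fset_set (word_ball S n).
have KP n g : (g \in K n) <-> word_ball S n g by exact: mem_word_ball.
have K_gt0 n : (0 < #|` K n|)%fset%N.
  by rewrite cardfs_gt0; apply/fset0Pn; exists 1%g; apply/KP/word_ball1.
have [m FHm] := fset_sub_word_ball _ _ (F `|` H)%fset genS.
have [|n Kn] := doubling_scale R (fun n => (#|` K n|)%fset%:R) d m Cst _ grow.
  by rewrite ltr0n.
(* The chain is [#A <= a |B_(2n+3m)| <= a (2^d+1) |B_n| < (2^d+1) b |B_n| <= (2^d+1) #B], the
   averaging costing one [m] on each side. *)
have cardBA x : (count (fun h => act h x \in A) (K (2 * (n + m))) <
    (2 ^ d).+1 * count (fun g => act g x \in B) (K (n + m)))%N.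
  have cA : (count (fun h => act h x \in A) (K (2 * (n + m))%N))%:R <=
      a * (#|` K (2 * n + 3 * m)%N|)%fset%:R.
    apply: (count_le_davg _ _ _ _ actA _ _ _ _ _ _ F0 aF) => s t sF /KP tN.
    apply/KP; rewrite (_ : _ + _ = m + 2 * (n + m))%N.
      by apply: word_ballM tN; apply/word_ballV/FHm => //; rewrite inE sF.
    by rewrite mulnDr addnCA -mulSn.
  have cB : b * (#|` K n|)%fset%:R <=
      (count (fun g => act g x \in B) (K (n + m)%N))%:R.
    apply: (count_ge_davg _ _ _ _ actA _ _ _ _ _ _ H0 bH) => s t sH /KP tK.
    apply/KP; rewrite addnC; apply: word_ballM tK.
    by apply: FHm; rewrite inE sH orbT.
  have a0 : 0 <= a by apply: le_trans (aF x); exact: davg_ge0.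
  rewrite -(ltr_nat R) natrM (le_lt_trans cA)//.
  apply: (le_lt_trans (ler_wpM2l a0 Kn)); rewrite mulrCA ltr_pM2l ?ltr0n//.
  by apply: lt_le_trans cB; rewrite ltr_pM2r ?ltr0n.
(* Every color starts with all of [B] as its room, and the list runs through all pairs. *)
have [|||||N [U [s [c [oU CU UB Udisj]]]]] := greedy_cover G X act (K (n + m)%N)
  (K (2 * (n + m))%N) (2 ^ d)%N pseudometric_normal actA act_cont _
  [seq (g, c) | g <- K (n + m)%N, c <- enum 'I_(2 ^ d).+1] _ C (fun=> B) cC _ _ _.
- move=> g h /KP gK /KP hK; apply/KP; rewrite mul2n -addnn.
  by apply: word_ballM hK; exact: word_ballV.
- by move=> g /mapP[_ /allpairsP[[h c] /= [hK _ ->]] ->].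
- by [].
- move=> x g c _ gK _; apply/allpairsP; exists (g, c); split=> //.
  by rewrite mem_enum.
- move=> x Cx; rewrite sum_nat_const card_ord.
  apply: leq_ltn_trans (cardBA x); apply: sub_count => h /=; rewrite !inE.
  exact: CA.
exists N, U, s, c; split=> //; split=> //; split=> // i.
by apply: subset_trans (UB i); apply: image_subset; exact: subset_closure.
Qed.
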